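(* Let $w\in F_k$ be a word in $k$ variables which has finite width $m$ in a profinite group $G$, and suppose that $w(G)$ has finite index in $G$. Then there is a choice of signs $(\varepsilon_1,\dots,\varepsilon_m)\in\{1,-1\}^m$ such that the image in $G$ of the word in $km$ disjoint variables $$w^{\ast m,(\varepsilon_1,\dots,\varepsilon_m)}(x_1,\dots,x_{km})=w(x_1,\dots,x_k)^{\varepsilon_1}\cdots w(x_{k(m-1)+1},\dots,x_{km})^{\varepsilon_m}$$ has positive Haar measure.
   Context: $F_k$ is the abstract free group on $k$ generators. For a group $G$, the set of $w$-values is $G^{\{w\}}=\{g\in G\mid\exists\,\boldsymbol h\in G^k:\ g=w(\boldsymbol h)^{\pm1}\}$ and $w(G)=\langle G^{\{w\}}\rangle$ is the (abstract) verbal subgroup generated by it. The word $w$ has finite width in $G$ if there is a positive integer $m$ such that every element of $w(G)$ is a product of at most $m$ $w$-values; the minimal such $m$ is the width of $w$ in $G$. The image of a word $v$ in $n$ variables in $G$ is $\{v(\boldsymbol h)\mid\boldsymbol h\in G^n\}$. *)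

(* Defs.v *)
From HB Require Import structures.
From mathcomp Require Import all_boot all_order all_algebra.
From mathcomp Require Import all_classical all_reals all_analysis.

Set Implicit Arguments.
Unset Strict Implicit.
Unset Printing Implicit Defensive.

Local Open Scope classical_set_scope.
Local Open Scope group_scope.

(* A letter (x, b) stands for x if b = false and for its inverse if b = true; *)
(* the free group on T is realised as the set of reduced words, multiplied by *)
(* concatenation followed by free reduction. Its universal property is given  *)
(* by word_evalM, word_eval_gen and word_eval_unique below.                   *)

Section FreeGroup.
Context {T : choiceType}.
Implicit Types (a b : T * bool) (s t u : seq (T * bool)).

Definition letter_inv a : T * bool := (a.1, ~~ a.2).

Definition reduced s : bool := sorted (fun a b => b != letter_inv a) s.

Definition cons_red a s : seq (T * bool) :=
  if s is b :: s' then if b == letter_inv a then s' else a :: s else [:: a].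

Definition free_reduce s : seq (T * bool) := foldr cons_red [::] s.

Lemma letter_invK : involutive letter_inv.
Proof. by case=> x b; rewrite /letter_inv /= negbK. Qed.

Lemma reduced_behead a s : reduced (a :: s) -> reduced s.
Proof. exact: path_sorted. Qed.

Lemma cons_red_reduced a s : reduced s -> reduced (cons_red a s).
Proof.
case: s => [|b s] //= rs; case: eqP => [_|/eqP nab]; first exact: path_sorted rs.
by rewrite /= nab.
Qed.

Lemma free_reduce_reduced s : reduced (free_reduce s).
Proof. by elim: s => //= a s; exact: cons_red_reduced. Qed.

Lemma free_reduce_id s : reduced s -> free_reduce s = s.
Proof.
elim: s => //= a s IHs rs; rewrite IHs; last exact: path_sorted rs.
by case: s rs {IHs} => //= b s /andP[/negPf ->].
Qed.

Lemma cons_redK a s : reduced s -> cons_red (letter_inv a) (cons_red a s) = s.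
Proof.
case: s => [|b s] /=; first by rewrite letter_invK eqxx.
case: eqP => [-> | _] rs; last by rewrite /= letter_invK eqxx.
case: s rs => [|c s] //= /andP[].
by rewrite letter_invK => /negPf ->.
Qed.

Lemma foldr_reduced s t : reduced t -> reduced (foldr cons_red t s).
Proof. by move=> rt; elim: s => //= a s; exact: cons_red_reduced. Qed.

Lemma foldr_cons_red a s t : reduced t ->
  foldr cons_red t (cons_red a s) = cons_red a (foldr cons_red t s).
Proof.
move=> rt; case: s => [|b s] //=; case: eqP => [->|//].
by have := cons_redK (letter_inv a) (foldr_reduced s rt); rewrite letter_invK => ->.
Qed.

Lemma foldr_free_reduce s t : reduced t ->
  foldr cons_red t (free_reduce s) = foldr cons_red t s.
Proof. by move=> rt; elim: s => //= a s <-; rewrite foldr_cons_red. Qed.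

Lemma free_reduce_cat s t :
  free_reduce (s ++ t) = foldr cons_red (free_reduce t) s.
Proof. by rewrite /free_reduce foldr_cat. Qed.

Lemma free_reduce_catl s t : free_reduce (free_reduce s ++ t) = free_reduce (s ++ t).
Proof. by rewrite !free_reduce_cat foldr_free_reduce ?free_reduce_reduced. Qed.

Lemma free_reduce_catr s t : free_reduce (s ++ free_reduce t) = free_reduce (s ++ t).
Proof.
by rewrite !free_reduce_cat (free_reduce_id (free_reduce_reduced t)).
Qed.

Definition word_inv s : seq (T * bool) := rev (map letter_inv s).

Lemma word_invK : involutive word_inv.
Proof. by move=> s; rewrite /word_inv map_rev revK mapK//; exact: letter_invK. Qed.

Lemma word_inv_reduced s : reduced s -> reduced (word_inv s).
Proof.
rewrite /reduced /word_inv rev_sorted sorted_map; apply: sub_sorted => a b /=.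
by rewrite letter_invK; apply: contra_neq => ->.
Qed.

Lemma free_reduce_mulV s : free_reduce (s ++ word_inv s) = [::].
Proof.
rewrite /word_inv; elim: s => //= a s IHs.
rewrite rev_cons -cats1 catA -free_reduce_catl IHs /=.
by rewrite eqxx.
Qed.

Record free_group_of : Type :=
  FreeGroupOf { free_word :> seq (T * bool); _ : reduced free_word }.

HB.instance Definition _ := [isSub for free_word].
HB.instance Definition _ := [Choice of free_group_of by <:].

Implicit Types x y z : free_group_of.

Definition fg_one : free_group_of := @FreeGroupOf [::] isT.
Definition fg_mul x y : free_group_of :=
  FreeGroupOf (free_reduce_reduced (val x ++ val y)).
Definition fg_inv x : free_group_of := FreeGroupOf (word_inv_reduced (valP x)).

Lemma fg_mulA : associative fg_mul.
Proof.
move=> x y z; apply: val_inj => /=.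
by rewrite free_reduce_catl free_reduce_catr catA.
Qed.

Lemma fg_mul1 : left_id fg_one fg_mul.
Proof. by move=> x; apply: val_inj; rewrite /= free_reduce_id ?(valP x). Qed.

Lemma fg_mulr1 : right_id fg_one fg_mul.
Proof. by move=> x; apply: val_inj; rewrite /= cats0 free_reduce_id ?(valP x). Qed.

Lemma fg_mulV : right_inverse fg_one fg_inv fg_mul.
Proof. by move=> x; apply: val_inj; rewrite /= free_reduce_mulV. Qed.

Lemma fg_mulVl : left_inverse fg_one fg_inv fg_mul.
Proof.
move=> x; apply: val_inj; rewrite /= -[X in _ ++ X]word_invK.
by rewrite free_reduce_mulV.
Qed.

HB.instance Definition _ := isGroup.Build free_group_of
  fg_mulA fg_mul1 fg_mulr1 fg_mulVl fg_mulV.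

Definition fg_gen (x : T) : free_group_of := @FreeGroupOf [:: (x, false)] isT.

End FreeGroup.

Arguments free_group_of : clear implicits.

Notation free_group k := (free_group_of 'I_k).

Definition sgn_pow {G : groupType} (e : bool) (g : G) : G :=
  if e then g^-1 else g.

Section Evaluation.
Context {T : choiceType} {G : groupType}.
Implicit Types (h : T -> G) (w : free_group_of T).

Definition letter_eval h (a : T * bool) : G := sgn_pow a.2 (h a.1).

Definition word_eval h w : G := \prod_(a <- val w) letter_eval h a.

Lemma letter_evalV h a : letter_eval h (letter_inv a) = (letter_eval h a)^-1.
Proof. by case: a => x []; rewrite /letter_eval /sgn_pow /= ?invgK. Qed.

Lemma prod_free_reduce h (s : seq (T * bool)) :
  \prod_(a <- free_reduce s) letter_eval h a = \prod_(a <- s) letter_eval h a.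
Proof.
elim: s => //= a s IHs; rewrite big_cons -IHs.
case: (free_reduce s) => [|b t] /=; first by rewrite big_cons.
case: eqP => [->|_]; last by rewrite big_cons.
by rewrite big_cons letter_evalV mulgA mulgV mul1g.
Qed.

Lemma word_evalM h : {morph word_eval h : u v / u * v}.
Proof. by move=> u v; rewrite /word_eval /= prod_free_reduce big_cat. Qed.

Lemma word_eval1 h : word_eval h 1 = 1.
Proof. by rewrite /word_eval big_nil. Qed.

Lemma word_evalV h : {morph word_eval h : u / u^-1}.
Proof.
move=> u; rewrite -[LHS]mulg1 -(mulgV (word_eval h u)) mulgA -word_evalM.
by rewrite mulVg word_eval1 mul1g.
Qed.

Lemma word_eval_gen h x : word_eval h (fg_gen x) = h x.
Proof. by rewrite /word_eval big_seq1. Qed.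

Lemma word_eval_unique h (f : free_group_of T -> G) :
  {morph f : u v / u * v} -> (forall x, f (fg_gen x) = h x) ->
  forall w, f w = word_eval h w.
Proof.
move=> fM fh.
have f1 : f 1 = 1 by apply: (mulgI (f 1)); rewrite -fM !mulg1.
have fV u : f u^-1 = (f u)^-1.
  by apply: (mulgI (f u)); rewrite -fM !mulgV.
case=> s rs; rewrite /word_eval /=; elim: s rs => [|a s IHs] ras.
  by rewrite big_nil -f1; congr f; exact: val_inj.
rewrite big_cons -(IHs (reduced_behead ras)).
have -> : FreeGroupOf ras =
    sgn_pow a.2 (fg_gen a.1) * FreeGroupOf (reduced_behead ras).
  apply: val_inj; rewrite /= -[LHS](free_reduce_id ras).
  by case: a ras => x [].
by rewrite fM; congr (_ * _); rewrite /letter_eval; case: a.2; rewrite /= ?fV fh.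
Qed.

End Evaluation.

Section VerbalSubgroups.
Context {k : nat} (w : free_group k) (G : groupType).

Definition word_values : set G :=
  [set g | exists h : 'I_k -> G, g = word_eval h w \/ g = (word_eval h w)^-1].

Definition is_subgroup (H : set G) : Prop :=
  [/\ H 1, (forall x y, H x -> H y -> H (x * y)) & (forall x, H x -> H x^-1)].

Definition verbal_subgroup : set G := smallest is_subgroup word_values.

Definition width_le (m : nat) : Prop :=
  forall g, verbal_subgroup g ->
    exists s : seq G,
      [/\ (size s <= m)%N, (forall x, x \in s -> word_values x)
        & g = \prod_(x <- s) x].

Definition has_width (m : nat) : Prop :=
  [/\ (0 < m)%N, width_le m
    & forall m', (0 < m')%N -> width_le m' -> (m <= m')%N].

Definition word_image : set G := [set word_eval h w | h in [set: 'I_k -> G]].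

End VerbalSubgroups.

Arguments word_values {k} w G _.
Arguments verbal_subgroup {k} w G _.
Arguments word_image {k} w G _.

Definition finite_index {G : groupType} (H : set G) : Prop :=
  finite_set [set [set g * x | x in H] | g in [set: G]].

(* Variables are numbered from 0: the j-th variable of the i-th block is      *)
(* x_(k * i + j).                                                            *)
Lemma block_var_proof (k m : nat) (i : 'I_m) (j : 'I_k) : (k * i + j < k * m)%N.
Proof.
apply: (@leq_trans (k * i.+1)); last by rewrite leq_mul2l ltn_ord orbT.
by rewrite mulnS addnC ltn_add2r.
Qed.

Definition block_var {k m : nat} (i : 'I_m) (j : 'I_k) : 'I_(k * m) :=
  Ordinal (block_var_proof i j).

(* w^{*m,eps}; eps i = true encodes the sign -1, eps i = false the sign 1. *)
Definition star_word {k : nat} (w : free_group k) (m : nat) (eps : 'I_m -> bool) :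
    free_group (k * m) :=
  \prod_(i < m)
    sgn_pow (eps i) (word_eval (fun j : 'I_k => fg_gen (block_var i j)) w).

HB.mixin Record isTopologicalGroup G of Group G & Topological G := {
  mulg_continuous : continuous (fun xy : G * G => xy.1 * xy.2);
  invg_continuous : continuous (fun x : G => x^-1)
}.

#[short(type="topologicalGroupType")]
HB.structure Definition TopologicalGroup :=
  {G of Group G & Topological G & isTopologicalGroup G}.

HB.mixin Record isProfinite G of TopologicalGroup G := {
  profinite_compact : compact [set: G];
  profinite_hausdorff : hausdorff_space G;
  profinite_totally_disconnected : totally_disconnected [set: G]
}.

#[short(type="profiniteGroupType")]
HB.structure Definition ProfiniteGroup :=
  {G of TopologicalGroup G & isProfinite G}.

(* Alias of G pointed at 1, since the library only generates sigma-algebras  *)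
(* on pointed types.                                                         *)
Definition pointed_at1 (G : Type) : Type := G.
HB.instance Definition _ (G : topologicalGroupType) :=
  Choice.on (pointed_at1 G).
HB.instance Definition _ (G : topologicalGroupType) :=
  isPointed.Build (pointed_at1 G) (1 : G).

Definition borel (G : topologicalGroupType) :=
  g_sigma_algebraType (@open G : set (set (pointed_at1 G))).

(* Normalised Haar measure of a compact group: the left-invariant regular    *)
(* Borel probability measure.                                                *)
Definition is_haar (R : realType) (G : topologicalGroupType)
    (mu : probability (borel G) R) : Prop :=
  [/\ (forall (g : G) (A : set G), measurable (A : set (borel G)) ->
         mu [set g * x | x in A] = mu A),
      (forall A : set G, measurable (A : set (borel G)) ->
         mu A = ereal_inf [set mu U | U in [set U : set G | open U /\ A `<=` U]])
    & (forall A : set G, measurable (A : set (borel G)) ->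
         mu A = ereal_sup [set mu K | K in [set K : set G | compact K /\ K `<=` A]])].

(* Main.v *)
Require Import Defs.
From mathcomp Require Import all_boot all_order all_algebra.
From mathcomp Require Import all_classical all_reals all_analysis.

(** The images of the [2 ^ m] words [star_word w eps] are compact, hence
    closed, and since [1] is itself a [w]-value they cover [w(G)].  Finitely
    many translates of them thus cover [G], and if all of them were null then
    [G] would be null by left invariance. *)

Import Order.TTheory.

Local Open Scope classical_set_scope.
Local Open Scope group_scope.

Lemma word_eval_const1 (T : choiceType) (G : groupType) (w : free_group_of T) :
  word_eval (fun=> 1 : G) w = 1.
Proof.
by apply: big1_seq => -[x []] _; rewrite /letter_eval /sgn_pow //= invg1.
Qed.

(** Both sides are homomorphisms in [w] that agree on the generators, so the universal property of
    the free group identifies them. *)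
Lemma word_eval_subst (T S : choiceType) (G : groupType) (h : S -> G)
    (f : T -> free_group_of S) (w : free_group_of T) :
  word_eval h (word_eval f w) = word_eval (fun x => word_eval h (f x)) w.
Proof.
apply: (@word_eval_unique _ _ _ (fun u => word_eval h (word_eval f u))) => [u v|x].
  by rewrite !word_evalM.
by rewrite word_eval_gen.
Qed.

Lemma word_eval_star (k m : nat) (w : free_group k) (eps : 'I_m -> bool)
    (G : groupType) (h : 'I_(k * m) -> G) :
  word_eval h (star_word w eps) =
    \prod_(i < m) sgn_pow (eps i) (word_eval (fun j => h (block_var i j)) w).
Proof.
rewrite /star_word (big_morph _ (word_evalM h) (word_eval1 h)).
apply: eq_bigr => i _.
have evalE : word_eval h (word_eval (fun j => fg_gen (block_var i j)) w) =
    word_eval (fun j => h (block_var i j)) w.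
  rewrite word_eval_subst; congr word_eval.
  by apply: funext => j; rewrite word_eval_gen.
by case: (eps i); rewrite /sgn_pow ?word_evalV evalE.
Qed.

(** The index [k * i + j] with [j < k] determines [i] and [j] by Euclidean division by [k]. *)
Lemma block_var_inj (k m : nat) (i i' : 'I_m) (j j' : 'I_k) :
  block_var i j = block_var i' j' -> i = i' /\ j = j'.
Proof.
have k_gt0 : (0 < k)%N by apply: leq_ltn_trans (ltn_ord j).
move=> /(congr1 val) /=; rewrite ![(k * _)%N]mulnC => e.
split; apply: val_inj => /=.
  by have := congr1 (divn^~ k) e; rewrite /= !divnMDl // !divn_small ?addn0.
by have := congr1 (modn^~ k) e; rewrite /= !modnMDl !modn_small.
Qed.

(** Distinct blocks use disjoint variables, so the arguments of the [m] copies of [w] can be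
    prescribed independently. The value [x0] only fills the branch where [pick] finds no pair. *)
Lemma block_var_glue (k m : nat) (X : Type) (x0 : X) (hh : 'I_m -> 'I_k -> X) :
  exists h : 'I_(k * m) -> X, forall i j, h (block_var i j) = hh i j.
Proof.
exists (fun n => if [pick p : 'I_m * 'I_k | block_var p.1 p.2 == n] is Some p
                 then hh p.1 p.2 else x0) => i j.
case: pickP => [p /eqP /block_var_inj[-> ->] //|/(_ (i, j)) /=].
by rewrite eqxx.
Qed.

Lemma prod_nth_ord (G : groupType) (m : nat) (s : seq G) : (size s <= m)%N ->
  \prod_(x <- s) x = \prod_(i < m) nth 1 s i.
Proof.
move=> sm; rewrite (big_nth 1) big_mkord (big_ord_widen _ _ sm) big_mkcond.
by apply: eq_bigr => i _; case: ltnP => // /(nth_default 1) ->.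
Qed.

Lemma verbal_subgroup_sub_star (k m : nat) (w : free_group k) (G : groupType) :
  width_le w G m ->
  verbal_subgroup w G `<=`
    \bigcup_(eps in [set: {ffun 'I_m -> bool}]) word_image (star_word w eps) G.
Proof.
move=> wm g /wm[s [sm sw ->]]; rewrite (prod_nth_ord _ _ _ sm).
have val_nth (i : 'I_m) :
    exists p : ('I_k -> G) * bool, nth 1 s i = sgn_pow p.2 (word_eval p.1 w).
  have [lt_is|le_si] := ltnP i (size s).
    have [h [e|e]] := sw _ (mem_nth 1 lt_is); first by exists (h, false).
    by exists (h, true).
  (* Past the end of [s] the factor is the padding value [1], obtained by evaluating [w] at the
     constant tuple [1]. *)
  by exists (fun=> 1, false); rewrite nth_default //= word_eval_const1.
have [p pE] := choice val_nth.
have [h hE] := block_var_glue k m G 1 (fun i => (p i).1).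
exists [ffun i => (p i).2] => //; exists h => //.
rewrite word_eval_star; apply: eq_bigr => i _.
by rewrite ffunE pE; congr (sgn_pow _ (word_eval _ w)); apply: funext.
Qed.

Lemma continuous_mulg (T : topologicalType) (G : topologicalGroupType)
    (f g : T -> G) :
  continuous f -> continuous g -> continuous (fun x => f x * g x).
Proof.
move=> fc gc x.
exact: (cvg_comp2 (fc x) (gc x) (@mulg_continuous G (f x, g x))).
Qed.

(** Induction on the letters: each factor is a coordinate [f i] or its inverse, and multiplication
    is continuous. *)
Lemma continuous_word_eval (S : choiceType) (w : free_group_of S)
    (T : topologicalType) (G : topologicalGroupType) (f : S -> T -> G) :
  (forall i, continuous (f i)) -> continuous (fun x => word_eval (f^~ x) w).
Proof.
move=> fc; rewrite /word_eval; elim: (val w) => [|[i b] s IHs].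
  under eq_fun do rewrite big_nil.
  exact: cst_continuous.
under eq_fun do rewrite big_cons.
apply: continuous_mulg => // x; rewrite /letter_eval /sgn_pow /=.
case: b; last exact: fc.
exact: (continuous_comp (fc i x) (@invg_continuous G (f i x))).
Qed.

(** By Tychonoff [G^n] is compact in the product topology, and evaluation of [w] is continuous on
    it. *)
Lemma compact_word_image (n : nat) (w : free_group n) (G : profiniteGroupType) :
  compact (word_image w G).
Proof.
apply: (@continuous_compact (prod_topology (fun _ : 'I_n => G))).
  apply: continuous_subspaceT.
  apply: (continuous_word_eval _ w _ G (fun i (h : prod_topology _) => h i)).
  exact: proj_continuous.
have := @tychonoff 'I_n (fun=> G) (fun=> setT) (fun=> profinite_compact).
by congr compact; apply/seteqP; split.
Qed.

Lemma compact_borel (G : profiniteGroupType) (K : set G) :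
  compact K -> measurable (K : set (borel G)).
Proof.
move=> /(compact_closed profinite_hausdorff) Kcl.
rewrite -[K]setCK; apply: measurableC; apply: sub_sigma_algebra.
exact: closed_openC.
Qed.

Lemma negligible_bigcup_finite (d : measure_display) (T : measurableType d)
    (R : realType) (mu : {measure set T -> \bar R}%R) (I : choiceType)
    (D : set I) (F : I -> set T) :
  finite_set D -> (forall i, D i -> mu.-negligible (F i)) ->
  mu.-negligible (\bigcup_(i in D) F i).
Proof.
move=> /finite_seqP[s ->] {D} Fneg; rewrite bigcup_seq big_seq.
elim/big_rec: _ => [|i A si Aneg]; first exact: negligible_set0.
exact: negligibleU (Fneg i si) Aneg.
Qed.

Theorem corollary2p7 (R : realType) (G : profiniteGroupType)
    (mu : probability (borel G) R) (haar_mu : is_haar mu)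
    (k : nat) (w : free_group k) (m : nat)
    (width_w : has_width w G m)
    (index_w : finite_index (verbal_subgroup w G)) :
  exists eps : 'I_m -> bool,
    measurable (word_image (star_word w eps) G : set (borel G)) /\
    (0 < mu (word_image (star_word w eps) G))%E.
Proof.
have [mu_inv _ _] := haar_mu; have [_ wm _] := width_w.
have meas_star (eps : 'I_m -> bool) :
    measurable (word_image (star_word w eps) G : set (borel G)).
  by apply: compact_borel; exact: compact_word_image.
apply: contrapT => /forallNP null_star.
have mu0 (eps : 'I_m -> bool) : mu (word_image (star_word w eps) G) = 0%E.
  apply/eqP; rewrite -measure_le0 leNgt; apply/negP => mu_gt0.
  exact: (null_star eps).
have coset_null (g : G) :
    mu.-negligible ([set g * x | x in verbal_subgroup w G] : set (borel G)).
  have : mu.-negligible (\bigcup_(eps in [set: {ffun 'I_m -> bool}])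
      ([set g * x | x in word_image (star_word w eps) G] : set (borel G))).
    apply: negligible_bigcup_finite => [|eps _]; first exact: finite_finset.
    (* Left invariance gives the translate measure zero; its measurability comes from compactness,
       as it is a continuous image of a compact set. *)
    apply/negligibleP; last exact: etrans (mu_inv g _ (meas_star eps)) (mu0 eps).
    apply: compact_borel; apply: continuous_compact.
      apply: continuous_subspaceT; apply: continuous_mulg => x.
        exact: cst_continuous.
      exact: cvg_id.
    exact: compact_word_image.
  apply: negligibleS => _ [x /(verbal_subgroup_sub_star _ _ _ _ wm)[eps _ xI] <-].
  by exists eps => //; exists x.
have : mu.-negligible [set: borel G].
  (* Finite index makes this union of cosets finite, hence null. *)
  have : mu.-negligible
      (\bigcup_(C in [set [set g * x | x in verbal_subgroup w G] | g in [set: G]])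
        (C : set (borel G))).
    by apply: negligible_bigcup_finite => // _ [g _ <-].
  apply: negligibleS => g _; exists [set g * x | x in verbal_subgroup w G].
    by exists g.
  (* Each [g] lies in its own coset, since [1] belongs to every subgroup containing the [w]-values
     and thus to their intersection. *)
  exists 1; last exact: mulg1.
  by move=> H [[]].
(* A null [G] contradicts the normalisation of [mu] to total mass [1]. *)
move=> /(measure_negligible measurableT) muT0.
have := probability_setT mu; rewrite [LHS]muT0 => /esym/eqP.
by rewrite gt_eqF // lte01.
Qed.
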